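(* Let $n\ge 2$, let $d_1,\dots,d_n$ be positive integers, let $S_1\subseteq\mathbb{R}^{d_1}$ be nonempty, and let $f_1,\dots,f_n:\mathbb{R}^{d_1}\times\cdots\times\mathbb{R}^{d_n}\to\mathbb{R}$. Define $F_i$, $x_i^{\ast}$, and, for each $T\in\mathbb{N}$ (all lower levels using the same iteration number $T_2=\dots=T_n=T$), the iterates $x_i^{(T)}(x_1)$ and the function $\tilde F_1=\tilde F_{1,T}$ as in the context. Assume: (i) $S_1$ is compact. (ii) For $i=1,\dots,n$, $f_i$ is jointly continuous. (iii) For $i=2,\dots,n$, the set of optimal solutions of the $i$th level problem $\min_{x_i\in\mathbb{R}^{d_i}}F_i(x_1,\dots,x_{i-1},x_i)$ with arbitrarily fixed $(x_1,\dots,x_{i-1})$ is a singleton $\{x_i^{\ast}(x_1,\dots,x_{i-1})\}$. (iv) For $i=2,\dots,n$, the optimal solution of the $i$th level problem remains bounded as $x_1$ varies in $S_1$. (v) $f_1(x_1,\cdot,\dots,\cdot)$ is uniformly Lipschitz continuous on $S_1$: there is a constant $\nu>0$ such that for every $x_1\in S_1$ the map $(x_2,\dots,x_n)\mapsto f_1(x_1,x_2,\dots,x_n)$ is Lipschitz continuous with constant $\nu$. (vi) For all $i=2,\dots,n$, the sequence $\{x_i^{(T)}(x_1)\}$ converges uniformly to $x_i^{\ast}(x_1)$ on $S_1$ as $T\to\infty$. Then: (a) The optimal value of $\min_{x_1\in S_1}\tilde F_{1,T}(x_1)$ converges to that of $\min_{x_1\in S_1}F_1(x_1)$ as $T\to\infty$.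 (b) The set of optimal solutions of $\min_{x_1\in S_1}\tilde F_{1,T}(x_1)$ converges to that of $\min_{x_1\in S_1}F_1(x_1)$; more precisely, denoting by $x_{1,T}^{\ast}$ an optimal solution of $\min_{x_1\in S_1}\tilde F_{1,T}(x_1)$, the sequence $\{x_{1,T}^{\ast}\}_{T=1}^{\infty}$ admits a convergent subsequence; and for every subsequence $\{x_{1,T_k}^{\ast}\}_{k=1}^{\infty}$ such that $x_{1,T_k}^{\ast}\to x_1^{\ast}$ as $k\to\infty$, the accumulation point $x_1^{\ast}$ is an optimal solution of $\min_{x_1\in S_1}F_1(x_1)$.
   Context: Exact problem. The $n$-level optimization problem is to minimize $f_1(x_1,x_2^{\ast},\dots,x_n^{\ast})$ over $x_1\in S_1$, where each $x_i^{\ast}$ ($i\ge2$) is the minimizer over $x_i\in\mathbb{R}^{d_i}$ of the $i$th level objective given the upper-level variables, with lower-level variables optimal. Recursively: $F_n=f_n$; for $i=n,n-1,\dots,2$, $x_i^{\ast}(x_1,\dots,x_{i-1})$ is the unique minimizer of $x_i\mapsto F_i(x_1,\dots,x_{i-1},x_i)$ over $\mathbb{R}^{d_i}$ (unique by assumption (iii)), and $F_{i-1}(x_1,\dots,x_{i-1})=f_{i-1}(x_1,\dots,x_{i-1},\bar x_i,\dots,\bar x_n)$, where $\bar x_i=x_i^{\ast}(x_1,\dots,x_{i-1})$ and, successively for $j=i+1,\dots,n$, $\bar x_j=x_j^{\ast}(x_1,\dots,x_{i-1},\bar x_i,\dots,\bar x_{j-1})$. The argument $x_1$ ranges over $S_1$,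 and $x_j$ over $\mathbb{R}^{d_j}$ for $j\ge2$. For $x_1\in S_1$ write $x_2^{\ast}(x_1)$ for the unique minimizer of $x_2\mapsto F_2(x_1,x_2)$ over $\mathbb{R}^{d_2}$ and, successively for $i=3,\dots,n$, $x_i^{\ast}(x_1)=x_i^{\ast}(x_1,x_2^{\ast}(x_1),\dots,x_{i-1}^{\ast}(x_1))$. So $F_1(x_1)=f_1(x_1,x_2^{\ast}(x_1),\dots,x_n^{\ast}(x_1))$, and the $n$-level problem is $\min_{x_1\in S_1}F_1(x_1)$. Approximate problem. For each $T\in\mathbb{N}$, and for $i=2,\dots,n$, $t=1,\dots,T$, there are given maps $\Phi_i^{(t)}:\mathbb{R}^{d_1}\times\cdots\times\mathbb{R}^{d_i}\to\mathbb{R}^{d_i}$ (the $t$th iteration formula of an iterative method for the approximated $i$th level problem; these may depend on $T$) and given constant initial points $x_i^{(0)}\in\mathbb{R}^{d_i}$. For $x_1\in S_1$, define successively for $i=2,\dots,n$ and $t=1,\dots,T$ $$x_i^{(t)}=\Phi_i^{(t)}(x_1,x_2^{(T)},\dots,x_{i-1}^{(T)},x_i^{(t-1)}),$$ and write $x_i^{(T)}(x_1)$ for the resulting final iterate. Set $\tilde F_{1,T}(x_1)=f_1(x_1,x_2^{(T)}(x_1),\dots,x_n^{(T)}(x_1))$. The approximate problem is $\min_{x_1\in S_1}\tilde F_{1,T}(x_1)$.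
   Formalization: Condition (iv) is taken as: each x_i^*(x_1,...,x_{i-1}) is bounded for x_1 in S_1 and x_2,...,x_{i-1} in bounded sets; if only the composites x_i^*(x_1) are bounded, (b) can fail when n = 3 or more. *)

(* Defs.v *)
From HB Require Import structures.
From mathcomp Require Import all_boot all_order all_algebra.
From mathcomp Require Import all_classical all_reals all_analysis.
Set Implicit Arguments.
Unset Strict Implicit.
Unset Printing Implicit Defensive.
Import Order.TTheory GRing.Theory Num.Theory.
Import numFieldNormedType.Exports.
Local Open Scope classical_set_scope.
Local Open Scope ring_scope.

(* There are n = m.+1 levels, indexed by 'I_m.+1: ord0 is the first (top)
   level, and the indices i with 0 < i are the lower levels 2, ..., n.
   The variable of level i lives in 'rV[R]_(d i). *)

(* R^{d_1} x ... x R^{d_n} with the product topology. *)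
Definition points (R : realType) (m : nat) (d : 'I_m.+1 -> nat) :=
  prod_topology (fun i : 'I_m.+1 => 'rV[R]_(d i)).

(* R^{d_1} x ... x R^{d_i}. *)
Definition prefix_points (R : realType) (m : nat) (d : 'I_m.+1 -> nat)
    (i : 'I_m.+1) :=
  forall j : {j : 'I_m.+1 | (j <= i)%N}, 'rV[R]_(d (val j)).

Definition restrict_prefix (R : realType) (m : nat) (d : 'I_m.+1 -> nat)
    (i : 'I_m.+1) (x : points R d) : prefix_points R d i :=
  fun j => x (val j).
#[global] Arguments restrict_prefix {R m d} i x _.

Definition argmin (R : realType) (X : Type) (A : set X) (g : X -> R) : set X :=
  [set x | A x /\ forall y, A y -> g x <= g y].

(* Extended-real, since the approximate objectives may be unbounded below. *)
Definition optimal_value (R : realType) (X : Type) (A : set X) (g : X -> R)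
    : \bar R :=
  ereal_inf [set (g x)%:E | x in A].

Definition levels_after (m : nat) (i : 'I_m.+1) : seq 'I_m.+1 :=
  [seq j : 'I_m.+1 <- enum 'I_m.+1 | (i < j)%N].

Section Exact.
Context (R : realType) (m : nat) (d : 'I_m.+1 -> nat).
Implicit Types (f : 'I_m.+1 -> points R d -> R) (x : points R d).

(* For s = [:: i; ...; n], all levels from i on: replace the coordinates
   x_i, ..., x_n of x, successively, by x_i^*(x_1, ..., x_{i-1}) and then by
   the responses of the levels below.  The recursive calls inside the argmin
   evaluate F_i; see best_response_cons. *)
Fixpoint best_response f (s : seq 'I_m.+1) x : points R d :=
  if s is i :: s' then
    best_response f s'
      (dfwith x i (get (argmin setT (fun y : 'rV[R]_(d i) =>
                        f i (best_response f s' (dfwith x i y))))))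
  else x.

(* F_i(x_1, ..., x_i), written as a function of the full vector x; it does not
   depend on the coordinates after i (level_obj_prefix). *)
Definition level_obj f (i : 'I_m.+1) x : R :=
  f i (best_response f (levels_after i) x).

(* The optimal solutions of min_{x_i} F_i(x_1, ..., x_{i-1}, x_i), which
   depend only on the coordinates of x before i (solutions_prefix). *)
Definition solutions f (i : 'I_m.+1) x : set 'rV[R]_(d i) :=
  argmin setT (fun y : 'rV[R]_(d i) => level_obj f i (dfwith x i y)).
#[global] Arguments solutions f i x _ : clear implicits.

(* x_i^*(x_1, ..., x_{i-1}); meaningful when solutions f i x is a singleton. *)
Definition opt f (i : 'I_m.+1) x : 'rV[R]_(d i) := get (solutions f i x).

Lemma best_response_cons f (i : 'I_m.+1) x :
  best_response f (i :: levels_after i) x =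
  best_response f (levels_after i) (dfwith x i (opt f i x)).
Proof. by []. Qed.

Lemma best_response_ext f (s : seq 'I_m.+1) x x' :
  (forall j, j \notin s -> x j = x' j) ->
  best_response f s x = best_response f s x'.
Proof.
elim: s x x' => [|i s IHs] x x' xx' /=.
  by apply: functional_extensionality_dep => j; exact: xx'.
have E (y : 'rV[R]_(d i)) : best_response f s (dfwith x i y) =
    best_response f s (dfwith x' i y).
  apply: IHs => j js; case: (eqVneq i j) => [<-|ij].
    by rewrite !dfwithin.
  by rewrite !dfwithout// xx'// inE eq_sym negb_or ij.
rewrite E; congr (best_response f s (dfwith x' i (get (argmin setT _)))).
by apply: funext => y; rewrite E.
Qed.

Lemma level_obj_prefix f (i : 'I_m.+1) x x' :
  (forall j : 'I_m.+1, (j <= i)%N -> x j = x' j) ->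
  level_obj f i x = level_obj f i x'.
Proof.
move=> xx'; congr (f i _); apply: best_response_ext => j.
by rewrite mem_filter mem_enum andbT -leqNgt; exact: xx'.
Qed.

Lemma solutions_prefix f (i : 'I_m.+1) x x' :
  (forall j : 'I_m.+1, (j < i)%N -> x j = x' j) ->
  solutions f i x = solutions f i x'.
Proof.
move=> xx'; congr argmin; apply: funext => y; apply: level_obj_prefix => j ji.
case: (eqVneq i j) => [<-|ij]; first by rewrite !dfwithin.
by rewrite !dfwithout// xx'// ltn_neqAle ji andbT eq_sym.
Qed.

(* (x_1, 0, ..., 0); the lower-level zeros are placeholders, overwritten
   before they are used. *)
Definition start (x1 : 'rV[R]_(d ord0)) : points R d :=
  dfwith (fun j : 'I_m.+1 => 0 : 'rV[R]_(d j)) ord0 x1.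

(* (x_1, x_2^*(x_1), ..., x_n^*(x_1)). *)
Definition exact_point f (x1 : 'rV[R]_(d ord0)) : points R d :=
  best_response f (levels_after ord0) (start x1).

(* This is also level_obj f ord0 (start x1), by conversion. *)
Definition F1 f (x1 : 'rV[R]_(d ord0)) : R := f ord0 (exact_point f x1).

End Exact.
#[global] Arguments solutions {R m d} f i x _.

Section Approximate.
Context (R : realType) (m : nat) (d : 'I_m.+1 -> nat).

(* x_i^(t), given the already computed coordinates of x before i. *)
Fixpoint iterate (i : 'I_m.+1) (Phi : nat -> prefix_points R d i -> 'rV[R]_(d i))
    (x0 : 'rV[R]_(d i)) (x : points R d) (t : nat) : 'rV[R]_(d i) :=
  if t is t'.+1 then
    Phi t (restrict_prefix i (dfwith x i (iterate Phi x0 x t')))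
  else x0.

(* (x_1, x_2^(T)(x_1), ..., x_n^(T)(x_1)), where Phi T i t is the t-th
   iteration map of level i used when the iteration number is T. *)
Definition approx_point
    (Phi : nat -> forall i : 'I_m.+1, nat -> prefix_points R d i -> 'rV[R]_(d i))
    (x0 : forall i : 'I_m.+1, 'rV[R]_(d i)) (T : nat)
    (x1 : 'rV[R]_(d ord0)) : points R d :=
  foldl (fun (x : points R d) i => dfwith x i (iterate (Phi T i) (x0 i) x T))
    (start x1) (levels_after ord0).

Definition F1_approx (f : 'I_m.+1 -> points R d -> R)
    (Phi : nat -> forall i : 'I_m.+1, nat -> prefix_points R d i -> 'rV[R]_(d i))
    (x0 : forall i : 'I_m.+1, 'rV[R]_(d i)) (T : nat)
    (x1 : 'rV[R]_(d ord0)) : R :=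
  f ord0 (approx_point Phi x0 T x1).

End Approximate.

(* Euclidean distance between (x_2, ..., x_n) and (y_2, ..., y_n). *)
Definition lower_dist (R : realType) (m : nat) (d : 'I_m.+1 -> nat)
    (x y : points R d) : R :=
  Num.sqrt (\sum_(i < m.+1 | (0 < i)%N)
              \sum_(k < d i) (x i ord0 k - y i ord0 k) ^+ 2).

(* Main.v *)
(* A minimiser that is unique and stays in a compact set depends continuously
   on the parameters, since every cluster point of nearby minimisers is again a
   minimiser.  Applied from the last level upwards, this makes the lower-level
   responses, hence F_1, continuous on S_1.  The Lipschitz bound turns the
   uniform convergence of the iterates into uniform convergence of the
   approximate objectives to F_1, and both claims follow from the compactness
   of S_1. *)

Require Import Defs.
From HB Require Import structures.
From mathcomp Require Import all_boot all_order all_algebra.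
From mathcomp Require Import all_classical all_reals all_analysis.
From mathcomp Require Import lra.
Set Implicit Arguments.
Unset Strict Implicit.
Unset Printing Implicit Defensive.
Import Order.TTheory GRing.Theory Num.Theory.
Import numFieldNormedType.Exports.
Local Open Scope classical_set_scope.
Local Open Scope ring_scope.

(** * Convergence of minimisers and convergence in the product topology *)

Lemma cvg_to_within (T : Type) (X : topologicalType) (F : set_system T)
    (u : T -> X) (x : X) (A : set X) :
  Filter F -> u @ F --> x -> (\forall t \near F, A (u t)) ->
  u @ F --> within A (nbhs x).
Proof. by move=> FF ux Au B /ux; apply: filterS2 Au => t /[swap]; exact. Qed.

(* The last hypothesis is continuous convergence of G x to g along F, weaker than
   joint continuity of a function on X * Y. *)
Lemma argmin_cvg (R : realType) (X : Type) (Y : topologicalType)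
    (F : set_system X) (G : X -> Y -> R) (g : Y -> R) (o : X -> Y) (y0 : Y)
    (V : set Y) :
  ProperFilter F -> hausdorff_space Y -> compact V -> nbhs y0 V ->
  (\forall x \near F, V (o x)) ->
  (\forall x \near F, argmin setT (G x) (o x)) ->
  argmin setT g = [set y0] ->
  (forall y, G p.1 p.2 @[p --> filter_prod F (nbhs y)] --> g y) ->
  o @ F --> y0.
Proof.
move=> FF hY cV V0 FV Fo gy0 Gg.
(* If some [z] did better than a cluster point [y], the midpoint [c] would separate [g z] from
   [g y]. For a suitable [x] with [o x] near [y] this gives [G x z < c < G x (o x)], against the
   minimality of [o x]. *)
have clu y : cluster (o @ F) y -> y = y0.
  move=> oy; suff : argmin setT g y by rewrite gy0.
  split=> // z _; rewrite leNgt; apply/negP => gzy.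
  pose c := (g z + g y) / 2.
  have gzc : g z < c by rewrite midf_lt.
  have cgy : c < g y by rewrite midf_lt.
  have [[A1 B1] [/= FA1 zB1] AB1] := @cvgr_lt _ _ _ _ _ _ (Gg z) _ gzc.
  have [[A2 B2] [/= FA2 yB2] AB2] := @cvgr_gt _ _ _ _ _ _ (Gg y) _ cgy.
  have /(oy _ B2) : (o @ F) (o @` [set x | [/\ A1 x, A2 x &
      argmin setT (G x) (o x)]]).
    rewrite /fmap/=; near=> x; exists x => //; split; near: x; exact.
  move=> /(_ yB2)[_ [[x [A1x A2x [_ /(_ z I) Gx]] <-] B2x]].
  have := AB1 (x, z) (conj A1x (nbhs_singleton zB1)).
  have := AB2 (x, o x) (conj A2x B2x) => /= cG Gc.
  by have := lt_trans (le_lt_trans Gx Gc) cG; rewrite ltxx.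
(* In a compact set a filter with a single cluster point converges to it; compactness also supplies
   that point. *)
apply: (compact_cluster_set1 hY cV V0) => //.
apply/seteqP; split=> [y /clu|_ ->] //.
have [y [_ oy]] := cV (o @ F) _ FV.
by rewrite -(clu _ oy).
Unshelve. all: by end_near. Qed.

(** The product topology is the supremum of the topologies pulled back along the projections, so
    only preimages of open sets under a single projection need testing. *)
Lemma prod_topology_cvg (I : Type) (K : I -> topologicalType) (T : Type)
    (F : set_system T) (u : T -> prod_topology K) (a : prod_topology K) :
  Filter F -> (forall i, u t i @[t --> F] --> a i) -> u @ F --> a.
Proof.
move=> FF ua; apply/cvg_sup => i A [B [[C oC <-] Cai] /filterS]; apply.
by apply: (ua i); exact: open_nbhs_nbhs.
Qed.

Lemma dfwith_cvg (I : eqType) (K : I -> topologicalType) (T : Type)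
    (F : set_system T) (u : T -> prod_topology K) (a : prod_topology K) (i : I)
    (v : T -> K i) (b : K i) :
  Filter F -> u @ F --> a -> v @ F --> b ->
  (dfwith (u t) i (v t) : prod_topology K) @[t --> F]
    --> (dfwith a i b : prod_topology K).
Proof.
move=> FF ua vb; apply: prod_topology_cvg => j.
have [<-|ij] := eqVneq i j.
  by rewrite dfwithin; under eq_cvg do rewrite dfwithin.
rewrite dfwithout//; under eq_cvg do rewrite dfwithout//.
exact: (cvg_comp _ _ ua (@proj_continuous _ K j a)).
Qed.

(** Both sides are strictly increasing lists with the same members, hence equal. *)
Lemma levels_after_cons (m : nat) (i j : 'I_m.+1) :
  j = i.+1 :> nat -> levels_after i = j :: levels_after j.
Proof.
move=> ij.
have so k : sorted (fun a b : 'I_m.+1 => a < b)%N (levels_after k).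
  apply: sorted_filter; first by move=> ? ? ?; exact: ltn_trans.
  by have := iota_ltn_sorted 0 m.+1; rewrite -val_enum_ord sorted_map.
apply: (@irr_sorted_eq _ (fun a b : 'I_m.+1 => a < b)%N) => //.
- by move=> ? ? ?; exact: ltn_trans.
- by move=> ?; exact: ltnn.
- rewrite /= path_sortedE; last by move=> ? ? ?; exact: ltn_trans.
  by apply/andP; split; [apply/allP => k; rewrite mem_filter => /andP[]|].
- move=> k; rewrite mem_filter mem_enum in_cons mem_filter mem_enum !andbT -ij.
  by rewrite leq_eqVlt eq_sym.
Qed.

Lemma levels_after_max (m : nat) (i : 'I_m.+1) :
  i = m :> nat -> levels_after i = [::].
Proof.
move=> im; apply/eqP; rewrite -[_ == _]negbK -has_filter; apply/hasPn => k _.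
by rewrite -leqNgt im -ltnS ltn_ord.
Qed.

(** * Optimal values, minimisers and subsequences in the limit *)

Lemma optimal_value_argmin (R : realType) (X : Type) (A : set X) (g : X -> R)
    (x : X) :
  argmin A g x -> optimal_value A g = (g x)%:E.
Proof.
move=> [Ax gx]; apply/le_anti/andP; split.
  by apply: ereal_inf_lbound; exists x.
by apply: le_ereal_inf_tmp => _ [y Ay <-]; rewrite lee_fin gx.
Qed.

(** The infimum of [h n], attained or not, is at least [g x - e] since [g x] is minimal, and at most
    [g x + e] by testing at [x]. *)
Lemma optimal_value_cvg (R : realType) (X : Type) (A : set X) (g : X -> R)
    (h : nat -> X -> R) (x : X) :
  argmin A g x ->
  (forall e, 0 < e -> \forall n \near \oo, forall y, A y -> `|g y - h n y| <= e) ->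
  optimal_value A (h n) @[n --> \oo] --> optimal_value A g.
Proof.
move=> gx gh; rewrite (optimal_value_argmin gx); have [Ax gmin] := gx.
have bounds e : 0 < e -> \forall n \near \oo,
    ((g x - e)%:E <= optimal_value A (h n) <= (g x + e)%:E)%E.
  move=> e0; apply: filterS (gh e e0) => n ghn; apply/andP; split.
    apply: le_ereal_inf_tmp => _ [y Ay <-]; rewrite lee_fin.
    by have := ghn _ Ay; have := gmin _ Ay; rewrite ler_norml; lra.
  apply: (@le_trans _ _ (h n x)%:E); first by apply: ereal_inf_lbound; exists x.
  by rewrite lee_fin; have := ghn _ Ax; rewrite ler_norml; lra.
(* The sandwich makes the infimum finite, so that convergence in the extended reals reduces to a
   real estimate. *)
have fin n e : ((g x - e)%:E <= optimal_value A (h n) <= (g x + e)%:E)%E ->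
    optimal_value A (h n) \is a fin_num.
  by case: (optimal_value A (h n)) => [r| |] // /andP[].
apply/fine_cvgP; split; first by apply: filterS (bounds 1 ltr01) => n /fin.
apply/cvgrPdist_le => e /bounds; apply: filterS => n /= b.
move: (b); rewrite -(fineK (fin _ _ b)) !lee_fin ler_norml => /andP[? ?].
by apply/andP; split; lra.
Qed.

Lemma argmin_cvg_limit (R : realType) (X : topologicalType) (A : set X)
    (g : X -> R) (h : nat -> X -> R) (u : nat -> X) (x : X) :
  closed A -> {within A, continuous g} ->
  (forall e, 0 < e -> \forall n \near \oo, forall y, A y -> `|g y - h n y| <= e) ->
  (forall n, argmin A (h n) (u n)) -> u @ \oo --> x -> argmin A g x.
Proof.
move=> clA cg gh hu ux.
have Au n : A (u n) by have [] := hu n.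
have Ax : A x by apply: (closed_cvg A clA _ _ ux); exact: nearW.
have gux : g (u n) @[n --> \oo] --> g x.
  have uA : u @ \oo --> within A (nbhs x).
    by apply: cvg_to_within => //; exact: nearW.
  apply: (cvg_comp _ _ uA).
  by move/subspace_continuousP : cg; exact.
split=> // y Ay; apply/ler_addgt0Pr => e e0.
(* The error is spent in thirds: from [g x] to [g (u n)], from there to [h n (u n)], and, after
   minimality, from [h n y] to [g y]. *)
have e3 : 0 < e / 3 by rewrite divr_gt0.
near \oo => n; have [_ /(_ _ Ay) huy] := hu n.
have ghn : forall z, A z -> `|g z - h n z| <= e / 3.
  by near: n; exact: gh.
have gxn : `|g x - g (u n)| <= e / 3.
  by near: n; move/cvgrPdist_le : gux; apply.
move: gxn (ghn _ Ay) (ghn _ (Au n)); rewrite !ler_norml => /andP[? ?].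
by move=> /andP[? ?] /andP[? ?]; lra.
Unshelve. all: by end_near. Qed.

Lemma compact_cvg_subsequence (R : realType) (X : pseudoMetricType R)
    (A : set X) (u : nat -> X) :
  compact A -> (forall n, (0 < n)%N -> A (u n)) ->
  exists s : nat -> nat, [/\ forall k, (0 < s k)%N,
    {homo s : k l / (k < l)%N} & exists a : X, u (s k) @[k --> \oo] --> a].
Proof.
move=> cA Au.
have [|a [_ cla]] := cA (u @ \oo) (fmap_proper_filter _ _).
  by exists 1%N => // n; exact: Au.
(* Letting the previous index fix the radius makes a single choice give both increasing indices and
   convergence to [a]. *)
have next (n : nat) : {p | (n < p)%N /\ ball a n.+1%:R^-1 (u p)}.
  apply: cid; have n0 : 0 < n.+1%:R^-1 :> R by rewrite invr_gt0.
  have : (u @ \oo) (u @` [set p | (n < p)%N]).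
    by rewrite /fmap/=; near=> p; exists p => //=; near: p; exists n.+1.
  by move=> /cla/(_ (nbhsx_ballx a _ n0))[_ [[p np <-] apn]]; exists p.
have [t [_ tP]] := dependent_choice next 0%N.
have tS k : (t k < t k.+1)%N by have [] := tP k.
have tge k : (k <= t k)%N by elim: k => // k /leq_ltn_trans; exact.
exists (t \o S); split=> [k|k l kl|].
- by rewrite /= (leq_trans _ (tge _)).
- by apply: (homo_ltn ltn_trans tS); rewrite ltnS.
- exists a; apply/cvg_ballP => e e0; near=> k.
  apply: (@le_ball _ _ _ k.+1%:R^-1).
    by apply/ltW; near: k; exact: (near_infty_natSinv_lt (PosNum e0)).
  apply: (@le_ball _ _ _ (t k).+1%:R^-1); last by have [] := tP k.
  by rewrite lef_pV2 ?posrE// ler_nat ltnS.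
Unshelve. all: by end_near. Qed.

(** * Comparison of distances and continuity of the responses *)

(** Each lower coordinate adds at most [e ^+ 2] to the squared distance. This links the entrywise
    balls of uniform convergence to the Euclidean Lipschitz bound. *)
Lemma lower_dist_le (R : realType) (m : nat) (d : 'I_m.+1 -> nat)
    (x y : points R d) (e : R) :
  0 <= e ->
  (forall (i : 'I_m.+1) k, (0 < i)%N -> `|x i ord0 k - y i ord0 k| <= e) ->
  lower_dist x y <= Num.sqrt (\sum_(i < m.+1 | (0 < i)%N) d i)%:R * e.
Proof.
move=> e0 xye; rewrite -[leRHS]ger0_norm ?mulr_ge0 ?sqrtr_ge0//.
rewrite -sqrtr_sqr ler_wsqrtr// exprMn sqr_sqrtr ?ler0n// natr_sum mulr_suml.
apply: ler_sum => i i0; rewrite mulr_natl -[X in _ *+ X]card_ord -sumr_const.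
by apply: ler_sum => k _; rewrite -real_normK ?num_real// lerXn2r ?nnegrE// xye.
Qed.

Lemma best_response_cvg (R : realType) (m : nat) (d : 'I_m.+1 -> nat)
    (S1 : set 'rV[R]_(d ord0)) (f : 'I_m.+1 -> points R d -> R) :
  (forall i, continuous (f i)) ->
  (forall (i : 'I_m.+1) (x : points R d),
     (0 < i)%N -> S1 (x ord0) -> solutions f i x = [set opt f i x]) ->
  (forall i : 'I_m.+1, (0 < i)%N ->
     forall B : forall j : 'I_m.+1, set 'rV[R]_(d j),
     (forall j, bounded_set (B j)) ->
     bounded_set [set opt f i x | x in [set x : points R d |
       S1 (x ord0) /\ forall j : 'I_m.+1, (0 < j < i)%N -> B j (x j)]]) ->
  forall (i : 'I_m.+1) (x : points R d), S1 (x ord0) ->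
    best_response f (levels_after i) y
      @[y --> within [set y : points R d | S1 (y ord0)] (nbhs x)]
    --> best_response f (levels_after i) x.
Proof.
move=> cf sol bnd i; pose D := [set y : points R d | S1 (y ord0)].
(* Induction from the last level upwards: the responses after [j], the successor of [i], are already
   continuous relative to [D]. *)
have [k] := ubnP (m - i); elim: k i => // k IHk i; rewrite ltnS => mik x Sx.
have [im|im] := eqVneq (i : nat) m.
  by rewrite levels_after_max//=; exact: cvg_within.
have im1 : (i.+1 < m.+1)%N by rewrite ltnS ltn_neqAle im -ltnS ltn_ord.
pose j : 'I_m.+1 := Ordinal im1; have j0 : (0 < j)%N by [].
have {}IHk : forall y, D y -> _ := IHk j _.
have mjk : (m - j < k)%N by rewrite (leq_trans _ mik)// ltn_sub2l.
rewrite (@levels_after_cons _ i j)//.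
have jN0 : j != ord0 by rewrite -val_eqE /= .
have Dfix (y : points R d) (z : 'rV[R]_(d j)) : D y -> D (dfwith y j z).
  by rewrite /D/= dfwithout.
have PD : ProperFilter (within D (nbhs x)).
  by apply: within_nbhs_proper; exact: subset_closure.
have idx : id @ within D (nbhs x) --> x by exact: cvg_within.
have ox : opt f j @ within D (nbhs x) --> opt f j x.
  (* Points near [x] have their coordinates in these unit balls, so the boundedness hypothesis
     bounds their optimal responses by a single [r]. *)
  pose B l := ball (x l) 1.
  have [|M [Mreal MB]] := bnd j j0 B.
    move=> l; exists (`|x l| + 1); split=> [|M xM y]; first exact: num_real.
    rewrite /B -ball_normE/= => xy; apply: le_trans (ltW xM).
    rewrite -(subrK (x l) y) addrC (le_trans (ler_normD _ _))// lerD2l.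
    by rewrite distrC ltW.
  pose r := `|M| + 1.
  have Br y : D y -> (forall l, B l (y l)) -> `|opt f j y| <= r.
    move=> Dy By; apply: (MB r); first by rewrite ltr_pwDr// ler_norm.
    by exists y.
  (* The margin [1] makes [V] a neighbourhood of [opt f j x], whose norm is at most [r]. *)
  pose V := [set z : 'rV[R]_(d j) | `|z| <= r + 1].
  apply: (@argmin_cvg R _ _ (within D (nbhs x))
    (fun y z => level_obj f j (dfwith y j z))
    (fun z => level_obj f j (dfwith x j z)) (opt f j) (opt f j x) V).
  - exact: norm_hausdorff.
  - apply: bounded_closed_compact.
      exists (r + 1); split=> [|N rN z Vz]; first exact: num_real.
      exact: le_trans Vz (ltW rN).
    by apply: preimage_closed (@closed_le _ _) => z _; exact: norm_continuous.
  - apply/nbhs_ballP; exists 1 => //= z; rewrite -ball_normE /V/= => xz.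
    rewrite -(subrK (opt f j x) z) addrC (le_trans (ler_normD _ _))// lerD//.
      by apply: Br => // l; exact: ballxx.
    by rewrite distrC ltW.
  - have nearB : \forall y \near within D (nbhs x), forall l, B l (y l).
      apply: filter_forall => l; apply: cvg_within.
      by apply: (@proj_continuous _ _ l x); exact: nbhsx_ballx.
    apply: filterS2 nearB (withinT D _) => y By Dy.
    by rewrite /V/= (le_trans (Br y Dy By))// lerDl.
  - apply: filterS (withinT D _) => y Dy.
    by have := sol j y j0 Dy; rewrite /solutions => ->.
  - exact: sol.
  (* Changing coordinate [j] does not leave [D], so the induction hypothesis applies jointly in the
     point and the trial value [z]. *)
  - move=> z; rewrite /level_obj; apply: (cvg_comp _ (f j)); last exact: cf.
    have dc : (fun p : points R d * 'rV[R]_(d j) => dfwith p.1 j p.2 : points R d)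
        @ filter_prod (within D (nbhs x)) (nbhs z)
        --> within D (nbhs (dfwith x j z : points R d)).
      apply: cvg_to_within.
        apply: (@dfwith_cvg _ _ _ (filter_prod (within D (nbhs x)) (nbhs z))
          fst x j snd z).
          exact: cvg_comp cvg_fst idx.
        exact: cvg_snd.
      exists (D, setT); first by split; [exact: withinT|exact: filterT].
      by move=> [y y'] [/= Dy _]; exact: Dfix.
    by apply: (cvg_comp _ _ dc); apply: IHk => //; exact: Dfix.
rewrite best_response_cons; under eq_cvg do rewrite best_response_cons.
have dc : (dfwith y j (opt f j y) : points R d) @[y --> within D (nbhs x)]
    --> within D (nbhs (dfwith x j (opt f j x) : points R d)).
  apply: cvg_to_within; first exact: dfwith_cvg.
  by apply: filterS (withinT D _) => y; exact: Dfix.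
by apply: (cvg_comp _ _ dc); apply: IHk => //; exact: Dfix.
Qed.

Lemma F1_continuous (R : realType) (m : nat) (d : 'I_m.+1 -> nat)
    (S1 : set 'rV[R]_(d ord0)) (f : 'I_m.+1 -> points R d -> R) :
  (forall i, continuous (f i)) ->
  (forall (i : 'I_m.+1) (x : points R d),
     (0 < i)%N -> S1 (x ord0) -> solutions f i x = [set opt f i x]) ->
  (forall i : 'I_m.+1, (0 < i)%N ->
     forall B : forall j : 'I_m.+1, set 'rV[R]_(d j),
     (forall j, bounded_set (B j)) ->
     bounded_set [set opt f i x | x in [set x : points R d |
       S1 (x ord0) /\ forall j : 'I_m.+1, (0 < j < i)%N -> B j (x j)]]) ->
  {within S1, continuous (F1 f)}.
Proof.
move=> cf sol bnd; apply/subspace_continuousP => x1 Sx1.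
apply: (cvg_comp _ (f ord0)); last exact: cf.
(* [start] maps [S1] into the set relative to which the responses are continuous. *)
have dc : start y @[y --> within S1 (nbhs x1)] -->
    within [set y : points R d | S1 (y ord0)] (nbhs (start x1)).
  apply: cvg_to_within.
    by apply: dfwith_cvg; [exact: cvg_cst|exact: cvg_within].
  by apply: filterS (withinT S1 _) => y; rewrite /= /start dfwithin.
apply: (cvg_comp _ _ dc); apply: best_response_cvg => //.
by rewrite /start dfwithin.
Qed.

(** * Uniform convergence of the approximate objectives *)

Lemma F1_approx_uniform (R : realType) (m : nat) (d : 'I_m.+1 -> nat)
    (S1 : set 'rV[R]_(d ord0)) (f : 'I_m.+1 -> points R d -> R)
    (Phi : nat -> forall i : 'I_m.+1, nat -> prefix_points R d i -> 'rV[R]_(d i))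
    (x0 : forall i : 'I_m.+1, 'rV[R]_(d i)) (nu : R) :
  0 < nu ->
  (forall x y : points R d, S1 (x ord0) -> x ord0 = y ord0 ->
     `|f ord0 x - f ord0 y| <= nu * lower_dist x y) ->
  (forall i : 'I_m.+1, (0 < i)%N ->
     {uniform S1, (fun (T : nat) x1 => approx_point Phi x0 T x1 i) @ \oo -->
                  (fun x1 => exact_point f x1 i)}) ->
  forall e, 0 < e -> \forall T \near \oo, forall x1, S1 x1 ->
    `|F1 f x1 - F1_approx f Phi x0 T x1| <= e.
Proof.
move=> nu0 lip unif e e0.
(* The factor lost between coordinatewise errors and values of [f ord0]; adding [1] makes it
   positive, so that [e / C] is a valid tolerance. *)
pose C := nu * Num.sqrt (\sum_(i < m.+1 | (0 < i)%N) d i)%:R + 1.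
have C0 : 0 < C by rewrite ltr_wpDl// mulr_ge0 ?sqrtr_ge0// ltW.
have eC : 0 < e / C by rewrite divr_gt0.
(* The guard [0 < i] sits under the filter so that the finitely many levels can later be
   intersected. *)
have near_i (i : 'I_m.+1) : \forall T \near \oo, (0 < i)%N ->
    forall x1, S1 x1 ->
    ball (exact_point f x1 i) (e / C) (approx_point Phi x0 T x1 i).
  have [i0|] := posnP i; first by apply: nearW.
  move=> i0; suff /(unif i i0) : nbhs
      ((fun x1 => exact_point f x1 i) : {uniform` S1 -> 'rV[R]_(d i)})
      [set g | forall x1, S1 x1 -> ball (exact_point f x1 i) (e / C) (g x1)].
    by move=> near_ball; near=> T => _; near: T; exact: near_ball.
  apply/uniform_nbhs; exists [set xy | ball xy.1 (e / C) xy.2]; split => //.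
  exact: entourage_ball (PosNum eC).
(* Only lower levels are overwritten, so both points keep the top coordinate [x1], as the Lipschitz
   bound requires. *)
have outS (s : seq 'I_m.+1) (g : points R d -> forall i, 'rV[R]_(d i)) x :
    ord0 \notin s -> foldl (fun x i => dfwith x i (g x i)) x s ord0 = x ord0.
  elim: s x => //= i s IHs x; rewrite inE negb_or => /andP[i0 s0].
  by rewrite IHs// dfwithout// eq_sym.
have outB (s : seq 'I_m.+1) (x : points R d) :
    ord0 \notin s -> best_response f s x ord0 = x ord0.
  elim: s x => //= i s IHs x; rewrite inE negb_or => /andP[i0 s0].
  by rewrite IHs// dfwithout// eq_sym.
have ord0_notin : (ord0 : 'I_m.+1) \notin levels_after ord0.
  by rewrite mem_filter.
near=> T => x1 Sx1.
have xe : exact_point f x1 ord0 = x1.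
  by rewrite /exact_point outB// /start dfwithin.
have xa : approx_point Phi x0 T x1 ord0 = x1.
  rewrite /approx_point (outS _ (fun x i => iterate (Phi T i) (x0 i) x T))//.
  by rewrite /start dfwithin.
apply: (le_trans (lip _ _ _ _)); rewrite ?xe ?xa//.
have H : forall i : 'I_m.+1, (0 < i)%N -> forall x1, S1 x1 ->
    ball (exact_point f x1 i) (e / C) (approx_point Phi x0 T x1 i).
  by near: T; exact: filter_forall.
have := @lower_dist_le R m d (exact_point f x1) (approx_point Phi x0 T x1)
  (e / C) (ltW eC).
move=> /(_ _)/(ler_wpM2l (ltW nu0))/le_trans; apply.
  by move=> i k /H/(_ _ Sx1) [_ /(_ ord0 k)]/ltW.
by rewrite mulrA mulrCA ger_pMr// ler_pdivrMr// mul1r lerDl.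
Unshelve. all: by end_near. Qed.

Theorem theorem4 (R : realType) (m : nat) (m_gt0 : (0 < m)%N)
  (d : 'I_m.+1 -> nat) (d_gt0 : forall i, (0 < d i)%N)
  (S1 : set 'rV[R]_(d ord0)) (S1_neq0 : S1 !=set0)
  (f : 'I_m.+1 -> points R d -> R)
  (Phi : nat -> forall i : 'I_m.+1, nat -> prefix_points R d i -> 'rV[R]_(d i))
  (x0 : forall i : 'I_m.+1, 'rV[R]_(d i))
  (S1_compact : compact S1)
  (f_continuous : forall i, continuous (f i))
  (singleton_solutions : forall (i : 'I_m.+1) (x : points R d),
     (0 < i)%N -> S1 (x ord0) -> solutions f i x = [set opt f i x])
  (bounded_solutions : forall i : 'I_m.+1, (0 < i)%N ->
     forall B : forall j : 'I_m.+1, set 'rV[R]_(d j),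
     (forall j, bounded_set (B j)) ->
     bounded_set [set opt f i x | x in [set x : points R d |
       S1 (x ord0) /\ forall j : 'I_m.+1, (0 < j < i)%N -> B j (x j)]])
  (f1_lipschitz : exists2 nu : R, 0 < nu &
     forall x y : points R d, S1 (x ord0) -> x ord0 = y ord0 ->
       `|f ord0 x - f ord0 y| <= nu * lower_dist x y)
  (uniform_convergence : forall i : 'I_m.+1, (0 < i)%N ->
     {uniform S1, (fun (T : nat) x1 => approx_point Phi x0 T x1 i) @ \oo -->
                  (fun x1 => exact_point f x1 i)}) :
  (optimal_value S1 (F1 f) \is a fin_num /\
   optimal_value S1 (F1_approx f Phi x0 T) @[T --> \oo]
     --> optimal_value S1 (F1 f)) /\
  (forall x1T : nat -> 'rV[R]_(d ord0),
     (forall T : nat, (0 < T)%N -> argmin S1 (F1_approx f Phi x0 T) (x1T T)) ->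
     (exists s : nat -> nat,
        [/\ forall k, (0 < s k)%N, {homo s : k l / (k < l)%N} &
            cvg (x1T (s k) @[k --> \oo])]) /\
     (forall (s : nat -> nat) (x1 : 'rV[R]_(d ord0)),
        (forall k, (0 < s k)%N) -> {homo s : k l / (k < l)%N} ->
        x1T (s k) @[k --> \oo] --> x1 ->
        argmin S1 (F1 f) x1)).
Proof.
have [nu nu0 lip] := f1_lipschitz.
have unif := F1_approx_uniform nu0 lip uniform_convergence.
have contF : {within S1, continuous (F1 f)}.
  exact: F1_continuous bounded_solutions.
(* A minimiser of [F1] makes the limit value finite and anchors the comparison of optimal values. *)
have [xm Sxm Fxm] := compact_EVT_min S1_neq0 S1_compact contF.
have xm_min : argmin S1 (F1 f) xm.
  by split=> [|y Sy]; [rewrite inE in Sxm|apply: Fxm; rewrite inE].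
split; first split.
- by rewrite (optimal_value_argmin xm_min).
- exact: optimal_value_cvg xm_min unif.
move=> x1T x1Tmin; split.
  have [|s [s0 sh [a xa]]] := compact_cvg_subsequence S1_compact (u := x1T).
    by move=> n /x1Tmin[].
  by exists s; split=> //; apply/cvg_ex; exists a.
move=> s x1 s0 sh sx1.
(* A strictly increasing [s] dominates the identity, so estimates valid for all large [T] pass to
   the subsequence. *)
have sge k : (k <= s k)%N.
  by elim: k => // k /leq_ltn_trans; apply; exact: sh.
apply: (@argmin_cvg_limit _ _ S1 (F1 f)
  (fun k => F1_approx f Phi x0 (s k)) (x1T \o s)) => //.
- by apply: compact_closed => //; exact: norm_hausdorff.
- move=> e /unif[N _ HN]; exists N => // k /= Nk.
  by apply: HN => /=; exact: leq_trans (sge k).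
- by move=> k; exact: x1Tmin.
Qed.
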